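(* Let $p$ be a prime. There exist uncountably many pairwise non-commensurable groups that are finitely generated, infinite, torsion, non-amenable, and residually-$p$.
   Context: Two groups are commensurable if they have isomorphic subgroups of finite index. A group is residually-$p$ if the intersection of its normal subgroups of $p$-power index is trivial; it is torsion if every element has finite order. *)

(* Defs.v *)
From Stdlib Require Import Reals List ZArith Znumtheory.
Import ListNotations.
Open Scope R_scope.

Record group := Group {
  carrier :> Type;
  mul : carrier -> carrier -> carrier;
  one : carrier;
  inv : carrier -> carrier;
  mulA : forall x y z, mul x (mul y z) = mul (mul x y) z;
  mul1g : forall x, mul one x = x;
  mulg1 : forall x, mul x one = x;
  mulVg : forall x, mul (inv x) x = one;
  mulgV : forall x, mul x (inv x) = one
}.
Arguments mul {g}. Arguments one {g}. Arguments inv {g}.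

Fixpoint gpow {G : group} (x : G) (n : nat) : G :=
  match n with O => one | S k => mul x (gpow x k) end.

Definition is_subgroup {G : group} (H : G -> Prop) : Prop :=
  H one /\ (forall x y, H x -> H y -> H (mul x y)) /\ (forall x, H x -> H (inv x)).

Definition is_normal {G : group} (H : G -> Prop) : Prop :=
  is_subgroup H /\ forall g x, H x -> H (mul (inv g) (mul x g)).

Definition has_index {G : group} (H : G -> Prop) (n : nat) : Prop :=
  exists l : list G, length l = n /\
    (forall x, exists g, In g l /\ H (mul (inv g) x)) /\
    (forall i j, (i < n)%nat -> (j < n)%nat -> i <> j ->
       ~ H (mul (inv (nth i l one)) (nth j l one))).

Definition finite_index {G : group} (H : G -> Prop) : Prop :=
  exists n, has_index H n.

Definition finitely_generated (G : group) : Prop :=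
  exists S : list G, forall H : G -> Prop, is_subgroup H ->
    (forall s, In s S -> H s) -> forall x, H x.

Definition infinite_group (G : group) : Prop :=
  ~ exists l : list G, forall x, In x l.

Definition torsion (G : group) : Prop :=
  forall x : G, exists n, (n > 0)%nat /\ gpow x n = one.

Definition residually_p (p : nat) (G : group) : Prop :=
  forall x : G,
    (forall N : G -> Prop, is_normal N -> (exists k, has_index N (p ^ k)) -> N x) ->
    x = one.

Definition amenable (G : group) : Prop :=
  exists m : (G -> Prop) -> R,
    (forall A, 0 <= m A) /\
    m (fun _ => True) = 1 /\
    (forall A B, (forall x, A x -> B x -> False) ->
       m (fun x => A x \/ B x) = m A + m B) /\
    (forall (g : G) A, m (fun x => A (mul (inv g) x)) = m A).

Definition commensurable (G1 G2 : group) : Prop :=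
  exists (H1 : G1 -> Prop) (H2 : G2 -> Prop) (f : G1 -> G2),
    is_subgroup H1 /\ finite_index H1 /\
    is_subgroup H2 /\ finite_index H2 /\
    (forall x, H1 x -> H2 (f x)) /\
    (forall x y, H1 x -> H1 y -> f (mul x y) = mul (f x) (f y)) /\
    (forall x y, H1 x -> H1 y -> f x = f y -> x = y) /\
    (forall y, H2 y -> exists x, H1 x /\ f x = y).

Definition countable_type (I : Type) : Prop :=
  exists f : I -> nat, forall i j, f i = f j -> i = j.

(* Main.v *)
From HB Require Import structures.
From mathcomp Require Import all_boot all_order all_algebra all_fingroup all_solvable.
From mathcomp Require Import boolp finmap generic_quotient zify.
From mathcomp Require classical_sets.
From Stdlib Require Lra.
Require Defs.
Import (coercions) Defs.
Set Implicit Arguments. Unset Strict Implicit. Unset Printing Implicit Defensive.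
Import GRing.Theory Num.Theory.
Local Open Scope quotient_scope.

(** The groups are quotients of a two-generator free monoid, by the relation of having equal
    values in every finite two-generator [p]-group that satisfies a given sparse family of
    relations [w ^ (p ^ e) = 1]; they are residually-[p] by definition, and torsion when the
    family bounds the order of every word.

    Non-amenability (after Schlage-Puchta's positive [p]-gradient).  Let [T] be such a [p]-group,
    of order [n].  Functions from the [2n] edges of its Cayley graph to [F_p] whose sums along
    all relator loops vanish form a space of dimension at least [3n/2]: the relator
    [w ^ (p ^ e)] costs [n / p ^ e] conditions if [w] has order [p ^ e] in [T], and none
    if the order is smaller.  As the semidirect extension of [T] defined by such a function is
    again a [p]-group satisfying the relations, the function is a gradient on each translate
    of a finite subset [F] of the group, so its restriction to a translate lies in a space of
    dimension at most [|F|].  Choose [3n/2] edges on which the functions are independent and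
    count them over the [n] translates of [F]: some generator [x] has
    [|F x] minus [F|] at least [|F| / 3].  By Hall's theorem this yields a paradoxical
    decomposition.

    With finitely many relators, the same count over the rationals gives a word of unbounded
    order in the finite [p]-quotients.  For such a word [u] the relation
    [u ^ (p ^ e) = 1] can be imposed, or excluded for ever by respecting a finite quotient in
    which it fails, so a group of this kind can be built outside any given countable list.
    Only countably many kernels belong to groups commensurable with a given countable group,
    because coset tables determine them, so a maximal pairwise non-commensurable subfamily,
    which exists by Zorn's lemma, is uncountable. *)

(** * Marked p-groups and edge functions *)

(* Words are positive: in a torsion group the inverse of a letter is a positive power of it. *)
Definition word := seq bool.

Section MarkedGroups.
Local Open Scope group_scope.

Definition wpow (w : word) n : word := flatten (nseq n w).
Definition ev (gT : finGroupType) (pi : bool -> gT) (w : word) : gT :=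
  \prod_(x <- w) pi x.

Lemma ev_nil (gT : finGroupType) (pi : bool -> gT) : ev pi [::] = 1.
Proof. exact: big_nil. Qed.

Lemma ev_cons (gT : finGroupType) (pi : bool -> gT) x w :
  ev pi (x :: w) = pi x * ev pi w.
Proof. exact: big_cons. Qed.

Lemma ev_cat (gT : finGroupType) (pi : bool -> gT) u v :
  ev pi (u ++ v) = ev pi u * ev pi v.
Proof. exact: big_cat. Qed.

Lemma ev_wpow (gT : finGroupType) (pi : bool -> gT) w n :
  ev pi (wpow w n) = ev pi w ^+ n.
Proof.
elim: n => [|n IH]; first by rewrite ev_nil.
by rewrite /wpow /= ev_cat IH expgS.
Qed.

Lemma wpowM w m n : wpow w (m * n) = wpow (wpow w m) n.
Proof.
have wD a b : wpow w (a + b) = wpow w a ++ wpow w b.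
  by rewrite /wpow nseqD flatten_cat.
by elim: n => [|n IH]; rewrite ?muln0 // mulnS wD IH.
Qed.

Definition pmark (p : nat) (gT : finGroupType) (pi : bool -> gT) : Prop :=
  p.-group [set: gT] /\ forall g, exists w, ev pi w = g.

(** The values of words form a submonoid of a finite group, hence a subgroup. By Cauchy's theorem
    each prime divisor of its order is the order of the value of some word, so it is [p]. *)
Lemma pmark_of (p : nat) (p_pr : prime p) (gT : finGroupType) (pi : bool -> gT) :
  (forall w, exists k, ev pi w ^+ (p ^ k) = 1) ->
  exists (hT : finGroupType) (rho : bool -> hT), pmark p rho /\
    forall u v, ev rho u = ev rho v <-> ev pi u = ev pi v.
Proof.
move=> pel; pose S := [set g | `[< exists w, ev pi w = g >]].
have evS w : ev pi w \in S by rewrite inE; apply/asboolP; exists w.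
have gS : group_set S.
  apply/group_setP; split; first by rewrite -(ev_nil pi).
  move=> x y; rewrite !inE => /asboolP [u <-] /asboolP [v <-].
  by apply/asboolP; exists (u ++ v); rewrite ev_cat.
pose G := Group gS.
have pG : p.-group G.
  apply/pgroupP => q q_pr /(Cauchy q_pr) [x xG ox].
  move: xG; rewrite inE => /asboolP [w ew].
  have [k] := pel w; rewrite ew => /eqP; rewrite -order_dvdn ox.
  by rewrite Euclid_dvdX // dvdn_prime2 // => /andP [].
pose rho b : subg_of G := subg G (pi b).
have erho w : sgval (ev rho w) = ev pi w.
  elim: w => [|b w IH]; first by rewrite !ev_nil.
  rewrite !ev_cons -IH /= subgK //.
  by have := evS [:: b]; rewrite ev_cons ev_nil mulg1.
exists (subg_of G), rho; split; last first.
  move=> u v; rewrite -!erho; split=> [-> //|]; exact: val_inj.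
split.
  by rewrite /pgroup cardsT card_sub /=.
move=> [g gG]; have := gG; rewrite inE => /asboolP [w ew].
by exists w; apply: val_inj; rewrite /= erho.
Qed.

Lemma pmark_pel p (gT : finGroupType) (pi : bool -> gT) : prime p ->
  pmark p pi -> exists k, forall g : gT, g ^+ (p ^ k) = 1.
Proof.
move=> p_pr [/p_natP [k ck] _]; exists k => g; apply/eqP.
by rewrite -order_dvdn -ck order_dvdG ?inE.
Qed.

Lemma pmark_prod (p : nat) (p_pr : prime p) (gT1 gT2 : finGroupType) (pi1 : bool -> gT1)
    (pi2 : bool -> gT2) : pmark p pi1 -> pmark p pi2 ->
  exists (hT : finGroupType) (rho : bool -> hT), pmark p rho /\
    forall u v, ev rho u = ev rho v <-> ev pi1 u = ev pi1 v /\ ev pi2 u = ev pi2 v.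
Proof.
move=> m1 m2; pose pi b := (pi1 b, pi2 b).
have epi w : ev pi w = (ev pi1 w, ev pi2 w).
  by elim: w => [|b w IH]; rewrite ?ev_nil // !ev_cons IH.
have [k1 k1P] := pmark_pel p_pr m1; have [k2 k2P] := pmark_pel p_pr m2.
have [|hT [rho [mr rP]]] := @pmark_of p p_pr _ pi.
  move=> w; exists (k1 + k2); rewrite -ev_wpow epi !ev_wpow.
  by rewrite expnD expgM k1P expg1n mulnC expgM k2P expg1n.
exists hT, rho; split=> // u v; rewrite rP !epi.
by split=> [[-> ->]|[-> ->]].
Qed.

Lemma pmark_trivial p : prime p -> exists (hT : finGroupType) (rho : bool -> hT),
  pmark p rho /\ forall w, ev rho w = 1.
Proof.
move=> p_pr; have ev1 w : ev (fun=> 1 : {perm bool}) w = 1 by rewrite /ev big1_eq.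
have [|hT [rho [m e]]] := @pmark_of p p_pr {perm bool} (fun=> 1).
  by move=> w; exists 0; rewrite ev1 expg1n.
by exists hT, rho; split=> // w; rewrite -(ev_nil rho); apply/e; rewrite !ev1.
Qed.

Section EdgeFunctions.
Variables (gT : finGroupType) (pi : bool -> gT) (A : zmodType).
Implicit Type c : {ffun gT * bool -> A}.

Fixpoint pathsum c q (w : word) : A :=
  if w is x :: w' then (c (q, x) + pathsum c (q * pi x)%g w')%R else 0%R.

Lemma pathsum_cat c q u v :
  pathsum c q (u ++ v) = (pathsum c q u + pathsum c (q * ev pi u)%g v)%R.
Proof.
elim: u q => [|x u IH] q /=; first by rewrite ev_nil mulg1 add0r.
by rewrite IH ev_cons mulgA addrA.
Qed.

Lemma pathsum_wpow c q w n : ev pi w = 1 -> pathsum c q (wpow w n) = (pathsum c q w *+ n)%R.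
Proof.
move=> w1; elim: n => [|n IH] //.
by rewrite /wpow /= pathsum_cat w1 mulg1 IH mulrS.
Qed.

Lemma pathsumD c d q w : pathsum (c + d)%R q w = (pathsum c q w + pathsum d q w)%R.
Proof.
elim: w q => [|x w IH] q /=; first by rewrite addr0.
by rewrite IH ffunE addrACA.
Qed.

(* Going once round a closed power of [w] gives the same sum from every point of a [w]-orbit. *)
Lemma pathsum_rot c q w n k : ev pi w ^+ n = 1 ->
  pathsum c (q * ev pi w ^+ k) (wpow w n) = pathsum c q (wpow w n).
Proof.
move=> wn; elim: k q => [|k IH] q; first by rewrite mulg1.
rewrite expgS mulgA IH.
have : pathsum c q (w ++ wpow w n) = pathsum c q (wpow w n ++ w).
  congr (pathsum c q _); elim: n {wn IH} => [|n IH]; first by rewrite cats0.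
  by rewrite /wpow /= -catA -IH.
rewrite !pathsum_cat ev_wpow wn mulg1 addrC.
by move/addIr.
Qed.

End EdgeFunctions.

(** Each letter acts on [gT * A] by moving along its edge of the Cayley graph and adding the value
    of [c] there; the two permutations generate the extension. *)
Lemma pmark_ext (p : nat) (p_pr : prime p) (gT : finGroupType) (pi : bool -> gT)
    (A : finZmodType) (c : {ffun gT * bool -> A}) m :
  pmark p pi -> (forall a : A, a *+ (p ^ m) = 0)%R ->
  exists (hT : finGroupType) (rho : bool -> hT), pmark p rho /\
    forall u v, ev rho u = ev rho v <->
      ev pi u = ev pi v /\ forall q, pathsum pi c q u = pathsum pi c q v.
Proof.
move=> mp pA.
pose s x (z : gT * A) := (z.1 * pi x, (z.2 + c (z.1, x))%R).
have s_inj x : injective (s x).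
  by move=> [q a] [r b] [] /mulIg -> /addIr ->.
pose sg x := perm (@s_inj x).
have esg w q a : ev sg w (q, a) = (q * ev pi w, (a + pathsum pi c q w)%R).
  elim: w q a => [|x w IH] q a; first by rewrite !ev_nil perm1 mulg1 addr0.
  by rewrite !ev_cons permM permE /s /= IH mulgA addrA.
have [k kP] := pmark_pel p_pr mp.
have [|hT [rho [mr rP]]] := @pmark_of p p_pr _ sg.
  move=> w; exists (k + m); rewrite -ev_wpow; apply/permP => -[q a].
  rewrite esg perm1 expnD wpowM ev_wpow pathsum_wpow ev_wpow ?kP //.
  by rewrite expg1n mulg1 pA addr0.
exists hT, rho; split=> // u v; rewrite rP; split.
  move=> e; split=> [|q].
    by have := esg u 1 0%R; rewrite e esg !mul1g => -[].
  by have := esg u q 0%R; rewrite e esg !add0r => -[].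
by move=> [e eq]; apply/permP => -[q a]; rewrite !esg e eq.
Qed.

End MarkedGroups.

(** * Solutions of the relator equations *)

(** Each condition costs at most one coordinate. If some solution of the earlier conditions violates
    the new one and vanishes on [B] off a single [i0], its multiples correct all other solutions at
    the price of [i0]. Otherwise the new condition follows from the earlier ones, unless [B] is
    empty, and then the zero function suffices. *)
Lemma free_coordinates (K : fieldType) (I : finType) (T : eqType)
    (phi : T -> {ffun I -> K^o} -> K) (l : seq T) :
  (forall t k c d, phi t (k *: c + d) = k * phi t c + phi t d)%R ->
  exists B : {set I}, #|I| <= #|B| + size l /\
    forall a : I -> K, exists c : {ffun I -> K^o},
      (forall t, t \in l -> phi t c = 0%R) /\ forall i, i \in B -> c i = a i.
Proof.
move=> lin.
have phi0 t : phi t 0%R = 0%R.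
  have := lin t 1%R 0%R 0%R; rewrite scaler0 add0r mul1r.
  by move/esym/(canRL (addrK _)); rewrite subrr.
have phiD t c d : phi t (c + d)%R = (phi t c + phi t d)%R.
  by rewrite -[c]scale1r lin mul1r scale1r.
have phiZ t k c : phi t (k *: c)%R = (k * phi t c)%R.
  by rewrite -[(k *: c)%R]addr0 lin phi0 addr0.
elim: l => [|t l [B [sB BP]]].
  exists setT; rewrite cardsT addn0; split=> // a.
  by exists [ffun i => a i]; split=> // i _; rewrite ffunE.
pose Z c := forall t', t' \in l -> phi t' c = 0%R.
have [|noz] := pselect (exists i0 z, [/\ i0 \in B, Z z, phi t z != 0%R &
    forall i, i \in B :\ i0 -> z i = 0%R]).
  move=> [i0 [z [i0B zZ tz zB]]]; exists (B :\ i0); split.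
    by move: sB; rewrite (cardsD1 i0 B) i0B [size (t :: l)]/=; lia.
  move=> a; have [c [cZ cB]] := BP a.
  exists ((- (phi t c / phi t z)) *: z + c)%R; split=> [t'|i iB].
    rewrite inE lin => /orP [/eqP -> | t'l]; last by rewrite (zZ _ t'l) (cZ _ t'l) mulr0 addr0.
    by rewrite mulNr divfK // addNr.
  rewrite !ffunE zB // /GRing.scale /= mulr0 add0r cB //.
  by move: iB; rewrite !inE => /andP [].
have [B0|[i0 i0B]] := set_0Vmem B.
  exists set0; move: sB; rewrite B0 cards0 => sB.
  split; first by rewrite [size _]/=; lia.
  by move=> a; exists 0%R; split=> i; rewrite ?inE.
have [e eP] : exists e : I -> {ffun I -> K^o}, forall i, Z (e i) /\
    forall j, j \in B -> e i j = (j == i)%:R%R.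
  have ex i : exists x : {ffun I -> K^o}, Z x /\ forall j, j \in B -> x j = (j == i)%:R%R.
    by have [c [cZ cB]] := BP (fun j => (j == i)%:R%R); exists c.
  by have [e eP] := choice ex; exists e.
have sumZ (z : {ffun I -> K^o}) t' : phi t' (\sum_(i in B) z i *: e i)%R =
    (\sum_(i in B) z i * phi t' (e i))%R.
  by rewrite (big_morph (phi t') (phiD t') (phi0 t')); apply: eq_bigr => i _.
have te i : i \in B -> phi t (e i) = 0%R.
  move=> iB; apply/eqP/negPn/negP => ei; apply: noz; exists i, (e i); split=> //.
    by case: (eP i).
  by move=> j; rewrite !inE => /andP [/negPf ji jB]; rewrite (eP i).2 // ji.
(* Subtracting from [z] its expansion in the [e i] leaves a solution that vanishes on [B]; by [noz]
   it cannot violate the new condition. *)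
have tZ z : Z z -> phi t z = 0%R.
  move=> zZ; pose s := (\sum_(i in B) z i *: e i)%R.
  suff : phi t (-1 *: s + z)%R = 0%R.
    rewrite lin sumZ big1 ?mulr0 ?add0r // => i iB.
    by rewrite te // mulr0.
  apply/eqP/negPn/negP => nz; apply: noz; exists i0, (-1 *: s + z)%R; split=> //.
    move=> t' t'l; rewrite lin zZ // sumZ big1 ?mulr0 ?addr0 // => i iB.
    by rewrite (eP i).1 // mulr0.
  move=> j; rewrite !inE => /andP [_ jB].
  rewrite !ffunE sum_ffunE (bigD1 j) //= big1; last first.
    move=> i /andP [iB ij]; rewrite !ffunE (eP i).2 //.
    by rewrite eq_sym (negPf ij) /GRing.scale /= mulr0.
  by rewrite !ffunE (eP j).2 // eqxx /GRing.scale /= mulr1 addr0 mulN1r addNr.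
exists B; split; first by rewrite [size _]/=; lia.
move=> a; have [c [cZ cB]] := BP a; exists c; split=> // t'.
by rewrite inE => /orP [/eqP -> | /cZ //]; apply: tZ.
Qed.

(* The newest relator comes first; the bound on exponents makes the sum of all [p ^ -e]
   at most 1/2. *)
Fixpoint sparse (L : seq (word * nat)) : bool :=
  if L is x :: L' then (size L' + 2 <= x.2) && sparse L' else true.

(** Counted from the oldest, starting at 0, relator [j] has exponent at least [j + 2], so the
    geometric series [n / 4 + n / 8 + ...] dominates the sum. *)
Lemma sparse_budget p L n : 1 < p -> sparse L ->
  2 * (\sum_(x <- L) n %/ p ^ x.2) <= n.
Proof.
move=> p_gt1 okL.
have le1 : \sum_(x <- L) n %/ p ^ x.2 <= \sum_(j < size L) n %/ 2 ^ (j + 2).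
  elim: L okL => [|x L IH] /=; first by rewrite big_nil.
  move=> /andP [xs /IH le]; rewrite big_cons big_ord_recr /= addnC leq_add //.
  apply: leq_div2l; first by rewrite expn_gt0.
  apply: leq_trans (_ : p ^ (size L + 2) <= _); first by rewrite leq_exp2r ?addn2.
  by rewrite leq_exp2l.
have le2 k m : \sum_(j < k) m %/ 2 ^ (j + 1) <= m.
  elim: k m => [|k IH] m; first by rewrite big_ord0.
  rewrite big_ord_recl /= add0n expn1.
  apply: leq_trans (_ : m %/ 2 + m %/ 2 <= _); last by lia.
  rewrite leq_add2l; apply: leq_trans (IH (m %/ 2)); apply: leq_sum => j _.
  by rewrite -divnMA -expnS /bump /=; apply: leq_div2l; rewrite ?expn_gt0 // leq_exp2l.
apply: leq_trans (le2 (size L) n).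
apply: leq_trans (_ : 2 * (\sum_(j < size L) n %/ 2 ^ (j + 2)) <= _).
  by rewrite leq_mul2l le1 orbT.
rewrite big_distrr /=; apply: leq_sum => j _.
have -> : (j + 2 = (j + 1).+1)%N by lia.
by rewrite expnSr divnMA mulnC; apply: leq_trunc_div.
Qed.

Section Conditions.
Variables (p : nat) (gT : finGroupType) (pi : bool -> gT).

Definition orbit_reps (w : word) : seq gT :=
  [seq fingroup.repr C | C <- enum (lcosets <[ev pi w]> [set: gT])%g].

(** By [pathsum_rot] one loop per orbit suffices. A relator whose value has a smaller power of [p]
    as order gets no loop: its closed path repeats a shorter one a multiple of [p] times, so its sum
    over [F_p] is zero anyway. *)
Definition loops (x : word * nat) : seq (word * gT) :=
  if #[ev pi x.1]%g == p ^ x.2 then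
    [seq (wpow x.1 (p ^ x.2), q) | q <- orbit_reps x.1]
  else [::].

Lemma size_loops x : size (loops x) <= #|gT| %/ p ^ x.2.
Proof.
rewrite /loops; case: eqP => // <-.
rewrite !size_map -cardE card_lcosets -divgS ?subsetT //.
by rewrite cardsT.
Qed.

Lemma size_all_loops L : 1 < p -> sparse L -> 2 * size (flatten (map loops L)) <= #|gT|.
Proof.
move=> p_gt1 okL; apply: leq_trans (sparse_budget #|gT| p_gt1 okL).
rewrite leq_mul2l /= size_flatten /shape -map_comp sumnE big_map.
by apply: leq_sum => x _; apply: size_loops.
Qed.

Lemma loops_all (A : zmodType) (c : {ffun gT * bool -> A}) (x : word * nat) :
  (forall t, t \in loops x -> pathsum pi c t.2 t.1 = 0%R) -> #[ev pi x.1]%g = p ^ x.2 ->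
  forall q, pathsum pi c q (wpow x.1 (p ^ x.2)) = 0%R.
Proof.
move=> cx ox q; pose C := (q *: <[ev pi x.1]>)%g.
have : fingroup.repr C \in C by apply: (mem_repr q); apply: lcoset_refl.
rewrite lcoset_sym => /lcosetP [y /cycleP [k ->] ->].
rewrite pathsum_rot -?ox ?expg_order // ox.
apply: (cx (wpow x.1 (p ^ x.2), fingroup.repr C)).
rewrite /loops ox eqxx; apply: map_f; apply: map_f.
by rewrite mem_enum; apply/lcosetsP; exists q; rewrite ?inE.
Qed.

Lemma pathsumZ (K : fieldType) (k : K) (c : {ffun gT * bool -> K^o}) q w :
  pathsum pi (k *: c)%R q w = (k * pathsum pi c q w)%R.
Proof.
elim: w q => [|x w IH] q /=; first by rewrite mulr0.
by rewrite IH ffunE mulrDr.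
Qed.

Lemma pathsum_raddf (A A' : zmodType) (f : {additive A -> A'}) (c : {ffun gT * bool -> A}) q w :
  f (pathsum pi c q w) = pathsum pi [ffun e => f (c e)] q w.
Proof.
elim: w q => [|x w IH] q /=; first by rewrite raddf0.
by rewrite raddfD IH ffunE.
Qed.

(** Of the [2 * #|gT|] edges, the relator loops cost at most [#|gT| / 2] and the conditions in
    [extra] one each. *)
Lemma many_edge_functions (K : fieldType) L (extra : seq (word * gT)) :
  1 < p -> sparse L -> exists B : {set gT * bool},
    3 * #|gT| <= 2 * (#|B| + size extra) /\
    forall a : gT * bool -> K, exists c : {ffun gT * bool -> K^o},
     [/\ forall x, x \in L -> #[ev pi x.1]%g = p ^ x.2 ->
           forall q, pathsum pi c q (wpow x.1 (p ^ x.2)) = 0%R,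
         forall t, t \in extra -> pathsum pi c t.2 t.1 = 0%R &
         forall i, i \in B -> c i = a i].
Proof.
move=> p_gt1 okL; pose l := flatten (map loops L) ++ extra.
have [|B [sB BP]] := @free_coordinates K (gT * bool)%type _
    (fun t c => pathsum pi c t.2 t.1) l.
  by move=> t k c d; rewrite pathsumD pathsumZ.
exists B; split.
  move: sB; rewrite size_cat card_prod card_bool.
  have := size_all_loops p_gt1 okL; move: (size (flatten _)) (size extra) #|B| => s e b.
  by move: #|gT| => n; lia.
move=> a; have [c [cl cB]] := BP a; exists c; split=> // [x xL ox q|t tl].
  apply: loops_all => // t tx; apply: cl; rewrite mem_cat; apply/orP; left.
  by apply/flatten_mapP; exists x.
by apply: cl; rewrite mem_cat tl orbT.
Qed.

End Conditions.

Definition sat p (R : word * nat -> Prop) (gT : finGroupType) (pi : bool -> gT) : Prop :=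
  forall x, R x -> (ev pi x.1 ^+ (p ^ x.2) = 1)%g.

Definition word_eq p (R : word * nat -> Prop) (u v : word) : Prop :=
  forall (gT : finGroupType) (pi : bool -> gT), pmark p pi -> sat p R pi -> ev pi u = ev pi v.

(** * Words of unbounded order *)

Section Extensions.
Variables (p : nat) (p_pr : prime p).

(** The conditions in [extra] exclude gradients: if all loops at 1 had sum zero, [c] would be the
    gradient of a potential vanishing at every point, hence zero. Clearing denominators makes a
    rational solution integral. *)
Lemma loop_with_nonzero_sum L (gT : finGroupType) (pi : bool -> gT) :
  sparse L -> pmark p pi -> (forall x, x \in L -> #[ev pi x.1]%g = p ^ x.2) ->
  exists (c : {ffun gT * bool -> int}) u,
    [/\ forall x, x \in L -> forall q, pathsum pi c q (wpow x.1 (p ^ x.2)) = 0%R,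
        ev pi u = 1%g & pathsum pi c 1%g u != 0%R].
Proof.
move=> okL [_ surj] ordL.
have [w wP] := choice surj.
pose extra := [seq (w q, 1%g : gT) | q <- enum gT].
have [B [sB BP]] := many_edge_functions pi rat extra (prime_gt1 p_pr) okL.
(* The [#|gT|] extra conditions still leave at least [#|gT| / 2] free edges. *)
have [e eB] : exists e, e \in B.
  apply/set0Pn; rewrite -card_gt0; move: sB; rewrite size_map -cardE.
  have : 0 < #|gT| by rewrite -cardsT cardG_gt0.
  move: #|gT| #|B| => n b; lia.
have [c [cL cE cB]] := BP (fun=> 1%R).
pose D : int := (\prod_i denq (c i))%R.
have D0 : D != 0%R by rewrite prodf_seq_neq0; apply/allP => i _; rewrite denq_neq0.
pose c' : {ffun gT * bool -> int} := [ffun i => numq (D%:~R * c i)%R].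
have c'E i : ((c' i)%:~R = D%:~R * c i :> rat)%R.
  rewrite ffunE /D (bigD1 i) //= rmorphM /= mulrAC [X in (X * _)%R]mulrC.
  by rewrite -{1 3}[c i]divq_num_den mulfVK ?intr_eq0 ?denq_neq0 // -rmorphM numq_int.
have c'sum q u : ((pathsum pi c' q u)%:~R = D%:~R * pathsum pi c q u :> rat)%R.
  elim: u q => [|x u IH] q /=; first by rewrite mulr0.
  by rewrite rmorphD /= c'E IH mulrDr.
have sum0 q u : pathsum pi c q u = 0%R -> pathsum pi c' q u = 0%R.
  by move=> s0; apply/eqP; rewrite -(intr_eq0 rat) c'sum s0 mulr0.
have sumN0 q u : pathsum pi c q u != 0%R -> pathsum pi c' q u != 0%R.
  by move=> s0; rewrite -(intr_eq0 rat) c'sum mulf_neq0 // intr_eq0.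
exists c'.
suff [u [u1 su]] : exists u, ev pi u = 1%g /\ pathsum pi c 1%g u != 0%R.
  by exists u; split=> // [x xL q|]; [apply/sum0/cL => //; apply: ordL | apply: sumN0].
case: e eB => q x /cB cqx.
(* The two paths from 1 to [q * pi x] have sums 0 and 1; close both up in the same way. *)
have cw r : pathsum pi c 1%g (w r) = 0%R.
  by apply: (cE (w r, 1%g)); apply: map_f; rewrite mem_enum.
pose v := w (q * pi x)^-1%g; pose s := pathsum pi c (q * pi x)%g v.
have s1 : pathsum pi c 1%g (w q ++ x :: v) = (1 + s)%R.
  by rewrite pathsum_cat cw add0r mul1g wP /= cqx.
have s2 : pathsum pi c 1%g (w (q * pi x)%g ++ v) = s.
  by rewrite pathsum_cat cw add0r mul1g wP.
have [s0|s0] := eqVneq s 0%R.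
  exists (w q ++ x :: v); rewrite s1 s0 addr0 oner_eq0; split=> //.
  by rewrite ev_cat ev_cons !wP mulgA mulgV.
exists (w (q * pi x)%g ++ v); rewrite s2; split=> //.
by rewrite ev_cat !wP mulgV.
Qed.

(** Reduced modulo [p ^ m], the integral function defines an extension in which [u ^ (p ^ b)]
    translates the fibre over 1 by [p ^ b * s]. Only the modulus depends on [b]. *)
Lemma exists_unbounded_word L (gT : finGroupType) (pi : bool -> gT) :
  sparse L -> pmark p pi -> (forall x, x \in L -> #[ev pi x.1]%g = p ^ x.2) ->
  exists u, forall b, exists (hT : finGroupType) (rho : bool -> hT),
    [/\ pmark p rho, sat p (fun x => x \in L) rho & (ev rho u ^+ (p ^ b) != 1)%g].
Proof.
move=> okL mpi ordL; have [c [u [cL u1 su]]] := loop_with_nonzero_sum okL mpi ordL.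
exists u => b; set s := pathsum pi c 1%g u in su.
(* Up to sign the translation is by [m] itself, and [0 < m < p ^ m] makes it nonzero modulo
   [p ^ m]. *)
pose m := (p ^ b * `|s|)%N.
have s_gt0 : 0 < `|s|%N by rewrite absz_gt0.
have m_gt0 : 0 < m by rewrite muln_gt0 s_gt0 expn_gt0 prime_gt0.
have pm_gt1 : 1 < p ^ m by rewrite -{1}(expn0 p) ltn_exp2l // prime_gt1.
pose f : {additive int -> 'Z_(p ^ m)} := intmul 1%R.
pose c' : {ffun gT * bool -> 'Z_(p ^ m)} := [ffun e => f (c e)].
have c'sum q v : pathsum pi c' q v = f (pathsum pi c q v) by rewrite pathsum_raddf.
have [|hT [rho [mr rP]]] := pmark_ext p_pr c' (m := m) mpi.
  by move=> a; rewrite -mulr_natr pchar_Zp // mulr0.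
exists hT, rho; split=> //.
  move=> x xL; rewrite -ev_wpow -(ev_nil rho); apply/rP; rewrite ev_wpow ev_nil.
  by rewrite -(ordL x xL) expg_order ordL //; split=> // q; rewrite c'sum cL //= rmorph0.
rewrite -ev_wpow -(ev_nil rho); apply/eqP => /rP [_ /(_ 1%g)].
rewrite c'sum pathsum_wpow // -/s /= => /eqP; rewrite -mulr_natr.
have sb0 : ((s * (p ^ b)%:R)%:~R : 'Z_(p ^ m))%R == 0%R -> (m%:R : 'Z_(p ^ m))%R == 0%R.
  rewrite /m natrM; case: (s) => k; rewrite ?NegzE ?abszN /= !rmorphM /= ?rmorphN /=.
    by rewrite mulrC rmorph_nat.
  by rewrite mulNr oppr_eq0 mulrC rmorph_nat.
have mm : m %% p ^ m = m by rewrite modn_small // ltn_expl // prime_gt1.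
move=> /sb0 /eqP m0; have := val_Zp_nat pm_gt1 m; rewrite mm m0 => m0'.
by rewrite -m0' in m_gt0.
Qed.

End Extensions.

(** A relator of exponent [e] yields loops only in groups of order at least [p ^ e > e], so each
    finite group sees a finite sparse part of a possibly infinite family. *)
Definition good (R : word * nat -> Prop) : Prop :=
  forall n, exists L, sparse L /\ forall x, R x -> x.2 <= n -> x \in L.

(** * Expansion in finite quotients *)

Section Expansion.
Variables (p : nat) (p_pr : prime p) (R : word * nat -> Prop) (goodR : good R).

Lemma many_cocycles (gT : finGroupType) (pi : bool -> gT) :
  pmark p pi -> sat p R pi -> exists B : {set gT * bool},
    3 * #|gT| <= 2 * #|B| /\
    forall a : gT * bool -> 'F_p, exists c : {ffun gT * bool -> 'F_p},
      (forall u v, word_eq p R u v -> forall q, pathsum pi c q u = pathsum pi c q v) /\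
      (forall e, e \in B -> c e = a e).
Proof.
move=> mpi satR; have [L [okL LP]] := goodR #|gT|.
have [B [sB BP]] := many_edge_functions pi 'F_p [::] (prime_gt1 p_pr) okL.
exists B; split; first by move: sB; rewrite addn0.
move=> a; have [c [cL _ cB]] := BP a; exists c; split=> // u v uv q.
have Fp0 (b : 'F_p) : (b *+ p = 0)%R by rewrite -mulr_natr pchar_Fp_0 // mulr0.
have [|hT [rho [mr rP]]] := pmark_ext p_pr (A := 'F_p) c (m := 1) mpi.
  by move=> b; rewrite expn1.
suff sr : sat p R rho by have [_ /(_ q)] := (rP u v).1 (uv _ _ mr sr).
move=> x Rx; rewrite -ev_wpow -(ev_nil rho); apply/rP; split.
  by rewrite ev_wpow ev_nil; apply: satR.
move=> r /=; have : #[ev pi x.1]%g %| p ^ x.2 by rewrite order_dvdn satR.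
move=> /(dvdn_pfactor _ _ p_pr) [f fle of_].
(* Either the value has full order and the loop condition was imposed, or the closed path repeats a
   shorter loop [p ^ (x.2 - f)] times, a multiple of [p]. *)
have [fe|fe] := eqVneq f x.2.
  apply: cL; rewrite ?of_ ?fe //; apply: LP => //.
  apply: leq_trans (_ : p ^ x.2 <= _); first exact/ltnW/ltn_expl/prime_gt1.
  by rewrite -fe -of_ -cardsT subset_leq_card ?subsetT.
have -> : x.2 = f + (x.2 - f).-1.+1 by lia.
rewrite expnD wpowM pathsum_wpow; last by rewrite ev_wpow -of_ expg_order.
by rewrite expnS mulrnA Fp0 mul0rn.
Qed.

Lemma expansion (F : finType) (wd : F -> word) (gT : finGroupType) (pi : bool -> gT) :
  pmark p pi -> sat p R pi -> injective (fun f => ev pi (wd f)) -> 0 < #|F| ->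
  exists x, 3 * #|[set f | `[< exists g, word_eq p R (rcons (wd f) x) (wd g) >]]| <= 2 * #|F|.
Proof.
move=> mpi satR inj F_gt0; have [B [sB BP]] := many_cocycles mpi satR.
pose D x := [set f | `[< exists g, word_eq p R (rcons (wd f) x) (wd g) >]].
have DP x f : f \in D x -> exists g, word_eq p R (rcons (wd f) x) (wd g).
  by rewrite inE => /asboolP.
apply: contrapT => /forallNP noD.
(* The free edges with both ends in the translate of [F] by [q]. *)
pose E q := [set e in B | [exists f in D e.2, e.1 == (q * ev pi (wd f))%g]].
have EP q e : e \in E q -> e \in B /\ exists f g,
    word_eq p R (rcons (wd f) e.2) (wd g) /\ e.1 = (q * ev pi (wd f))%g.
  rewrite inE => /andP [eB /existsP [f /andP [/DP [g fg] /eqP ->]]].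
  by split=> //; exists f, g.
(* Arbitrary values on [E q] extend to some [c], and are differences of its potential [phi] on [F];
   hence [p ^ #|E q| <= p ^ #|F|]. *)
have cE q : #|E q| <= #|F|.
  have [c cP] := choice (fun a : {ffun {e | e \in E q} -> 'F_p} =>
    BP (fun e => if insub e is Some e' then a e' else 0%R)).
  pose phi a : {ffun F -> 'F_p} := [ffun f => pathsum pi (c a) q (wd f)].
  have phi_inj : injective phi.
    move=> a b eab; apply/ffunP => -[e eE].
    have ecE a' : c a' e = a' (Sub e eE).
      by have [eB _] := EP q e eE; rewrite (cP a').2 // insubT.
    rewrite -!ecE; have [_ [f [g [fg e1]]]] := EP q e eE.
    have cphi a' : c a' e = (phi a' g - phi a' f)%R.
      rewrite !ffunE -((cP a').1 _ _ fg q) -cats1 pathsum_cat /= addr0 addrC addrA.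
      by rewrite addNr add0r -e1; case: (e).
    by rewrite !cphi eab.
  have := leq_card phi phi_inj; rewrite !card_ffun card_Fp // card_sig.
  by rewrite leq_exp2l // prime_gt1.
have sumE : \sum_q #|E q| <= #|gT| * #|F|.
  by rewrite -sum_nat_const; apply: leq_sum => q _; apply: cE.
(* By [inj], an edge [e] of [B] is counted for at least [#|D e.2|] points [q], which exceeds two
   thirds of [#|F|]. With [#|B|] at least [3 * #|gT| / 2] this contradicts [sumE]. *)
have : #|B| * (2 * #|F|).+1 <= 3 * \sum_q #|E q|.
  have -> : \sum_q #|E q| =
      \sum_(e in B) #|[set q | [exists f in D e.2, e.1 == (q * ev pi (wd f))%g]]|.
    under eq_bigr => q _ do rewrite -sum1_card.
    rewrite (exchange_big_dep (mem B)) /=; last by move=> q e _; rewrite inE => /andP [].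
    apply: eq_bigr => e eB; rewrite -sum1_card; apply: eq_bigl => q.
    by rewrite !inE eB.
  rewrite -sum_nat_const big_distrr /=; apply: leq_sum => e eB.
  have : ~ (3 * #|D e.2| <= 2 * #|F|) by apply: noD.
  move/negP; rewrite -ltnNge => /leq_trans; apply.
  rewrite leq_mul2l /= -(card_in_imset (f := fun f => (e.1 * (ev pi (wd f))^-1)%g)).
    apply: subset_leq_card; apply/subsetP => q /imsetP [f fD ->].
    by rewrite inE; apply/existsP; exists f; rewrite fD mulgKV eqxx.
  by move=> f g _ _ /mulgI /invg_inj /inj.
have : 0 < #|gT| by rewrite -cardsT cardG_gt0.
move: sB sumE F_gt0; move: (\sum_q _) #|gT| #|B| #|F| => s n b f; nia.
Qed.

End Expansion.

(** * The group defined by a family of relators *)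

Lemma InP (T : eqType) (x : T) (l : seq T) : List.In x l <-> x \in l.
Proof.
elim: l => [|y l IH] //=; rewrite inE IH.
split=> [[->|->]|/orP [/eqP ->|]]; rewrite ?eqxx ?orbT //; auto.
Qed.

Lemma list_nthE (T : Type) (d : T) i l : List.nth i l d = nth d l i.
Proof. by elim: l i => [|x l IH] [|i] //=. Qed.

Lemma nat_powE m n : Nat.pow m n = m ^ n.
Proof. by elim: n => [|n IH] //=; rewrite IH expnS. Qed.

Section WordEq.
Variables (p : nat) (p_pr : prime p) (R : word * nat -> Prop).

Lemma word_eq_sym u v : word_eq p R u v -> word_eq p R v u.
Proof. by move=> uv gT pi m s; rewrite (uv gT pi m s). Qed.

Lemma word_eq_trans u v w : word_eq p R u v -> word_eq p R v w -> word_eq p R u w.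
Proof. by move=> uv vw gT pi m s; rewrite (uv gT pi m s) (vw gT pi m s). Qed.

Lemma word_eq_cat u u' v v' :
  word_eq p R u u' -> word_eq p R v v' -> word_eq p R (u ++ v) (u' ++ v').
Proof. by move=> uu vv gT pi m s; rewrite !ev_cat (uu gT pi m s) (vv gT pi m s). Qed.

(** Each inequality holds in some finite quotient, and a product of marked groups keeps those of
    both factors. *)
Lemma separate (l : seq (word * word)) :
  (forall x, x \in l -> ~ word_eq p R x.1 x.2) ->
  exists (gT : finGroupType) (pi : bool -> gT),
    [/\ pmark p pi, sat p R pi & forall x, x \in l -> ev pi x.1 <> ev pi x.2].
Proof.
elim: l => [|[u v] l IH] ne.
  have [gT [pi [m e]]] := pmark_trivial p_pr.
  by exists gT, pi; split=> // x _; rewrite e expg1n.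
have [|gT1 [pi1 [m1 s1 ne1]]] := IH; first by move=> x xl; apply: ne; rewrite inE xl orbT.
have /existsNP [gT2 /existsNP [pi2 /not_implyP [m2 /not_implyP [s2 ne2]]]] :=
  ne (u, v) (mem_head _ _).
have [gT [pi [m e]]] := pmark_prod p_pr m1 m2.
exists gT, pi; split=> //.
  by move=> x Rx; rewrite -ev_wpow -(ev_nil pi); apply/e; rewrite !ev_wpow !ev_nil s1 // s2.
by move=> x; rewrite inE => /orP [/eqP -> /e [_]|/ne1 nx /e []].
Qed.

Definition weqb : rel word := fun u v => `[< word_eq p R u v >].

Lemma weqb_refl : reflexive weqb. Proof. by move=> w; apply/asboolP. Qed.
Lemma weqb_sym : symmetric weqb.
Proof. by move=> u v; apply/asboolP/asboolP => /word_eq_sym. Qed.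
Lemma weqb_trans : transitive weqb.
Proof. by move=> v u w /asboolP uv /asboolP vw; apply/asboolP/(word_eq_trans uv vw). Qed.

Canonical weq_equiv := EquivRel weqb weqb_refl weqb_sym weqb_trans.

Definition wquot := {eq_quot weq_equiv}.
HB.instance Definition _ := Choice.on wquot.
Definition cls (w : word) : wquot := \pi_({eq_quot weq_equiv}) w.
Definition rep (x : wquot) : word := repr (x : {eq_quot weq_equiv}).

Lemma repK x : cls (rep x) = x. Proof. exact: reprK. Qed.

Lemma clsP u v : cls u = cls v <-> word_eq p R u v.
Proof. by rewrite /cls; split=> [/eqmodP /asboolP | ?] //; apply/eqmodP/asboolP. Qed.

Lemma rep_cls w : word_eq p R (rep (cls w)) w.
Proof. by apply/clsP; rewrite repK. Qed.

Definition qmul (x y : wquot) : wquot := cls (rep x ++ rep y).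

Lemma qmul_cls u v : qmul (cls u) (cls v) = cls (u ++ v).
Proof. by apply/clsP; apply: word_eq_cat; apply: rep_cls. Qed.

Hypothesis tors : forall w, exists e, word_eq p R (wpow w (p ^ e)) [::].

Definition winv (w : word) : word := wpow w (p ^ projT1 (cid (tors w))).-1.

Lemma winv_cat w : word_eq p R (winv w ++ w) [::].
Proof.
rewrite /winv; case: (cid _) => e /= we; apply: word_eq_trans we => gT pi _ _.
by rewrite ev_cat !ev_wpow -expgSr prednK // expn_gt0 prime_gt0.
Qed.

Lemma cat_winv w : word_eq p R (w ++ winv w) [::].
Proof.
rewrite /winv; case: (cid _) => e /= we; apply: word_eq_trans we => gT pi _ _.
by rewrite ev_cat !ev_wpow -expgS prednK // expn_gt0 prime_gt0.
Qed.

Definition qinv (x : wquot) : wquot := cls (winv (rep x)).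

Lemma qmulA x y z : qmul x (qmul y z) = qmul (qmul x y) z.
Proof. by rewrite -[x]repK -[y]repK -[z]repK !qmul_cls catA. Qed.
Lemma qmul1 x : qmul (cls [::]) x = x.
Proof. by rewrite -[x]repK qmul_cls. Qed.
Lemma qmulr1 x : qmul x (cls [::]) = x.
Proof. by rewrite -[x]repK qmul_cls cats0. Qed.
Lemma qmulV x : qmul (qinv x) x = cls [::].
Proof. by rewrite -{2}[x]repK qmul_cls; apply/clsP/winv_cat. Qed.
Lemma qmulrV x : qmul x (qinv x) = cls [::].
Proof. by rewrite -{1}[x]repK qmul_cls; apply/clsP/cat_winv. Qed.

Definition qgroup : Defs.group :=
  @Defs.Group wquot qmul (cls [::]) qinv qmulA qmul1 qmulr1 qmulV qmulrV.

Lemma qgroup_fg : Defs.finitely_generated qgroup.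
Proof.
exists [:: cls [:: true]; cls [:: false]] => H [H1 [HM HV]] Hs x.
rewrite -[x]repK; elim: (rep x) => [|b w IH]; first exact: H1.
rewrite -[b :: w]/([:: b] ++ w) -qmul_cls; apply: HM => //; apply: Hs.
by case: b; [left | right; left].
Qed.

Lemma qgroup_torsion : Defs.torsion qgroup.
Proof.
move=> x; have [e we] := tors (rep x); exists (p ^ e); split.
  by apply/ltP; rewrite expn_gt0 prime_gt0.
suff gE n : @Defs.gpow qgroup x n = cls (wpow (rep x) n) by rewrite gE; apply/clsP.
elim: n => [|n IH] //=; rewrite IH -{1}[x]repK; exact: qmul_cls.
Qed.

Lemma qgroup_residually_p : Defs.residually_p p qgroup.
Proof.
move=> x Nx; rewrite -[x]repK; apply/clsP => gT pi mpi s.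
have evr w : ev pi (rep (cls w)) = ev pi w by apply: rep_cls.
have evM y z : ev pi (rep (qmul y z)) = (ev pi (rep y) * ev pi (rep z))%g.
  by rewrite evr ev_cat.
have evV y : ev pi (rep (qinv y)) = (ev pi (rep y))^-1%g.
  by apply/eqP; rewrite eq_sym eq_invg_mul -evM qmulrV evr ev_nil.
(* The kernel of the map onto [gT]: the words [w g] represent its cosets, so its index is [#|gT|], a
   power of [p]. *)
pose N (y : wquot) := ev pi (rep y) = 1%g.
rewrite ev_nil; apply: (Nx N).
  split; first split; first by rewrite /N evr ev_nil.
    split=> [y z|y]; rewrite /N /= ?evM ?evV; first by move=> -> ->; rewrite mulg1.
    by move=> ->; rewrite invg1.
  by move=> g y; rewrite /N /= !evM evV => ->; rewrite mul1g mulVg.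
have [/p_natP [k ck] surj] := mpi; exists k.
have [w wP] := choice surj.
have sz : size [seq cls (w g) | g <- enum gT] = #|gT| by rewrite size_map -cardE.
exists [seq cls (w g) | g <- enum gT]; rewrite nat_powE -ck cardsT.
split; first by rewrite -sz.
split=> [y|i j /ltP lti /ltP ltj ij].
  exists (cls (w (ev pi (rep y)))); split.
    by apply/InP/map_f; rewrite mem_enum.
  by rewrite /N /= evM evV evr wP mulVg.
pose g0 : gT := 1%g; rewrite cardE in lti ltj.
rewrite !list_nthE (nth_map g0 _ _ lti) (nth_map g0 _ _ ltj).
rewrite /N [Defs.mul _ _]/= evM evV !evr !wP => /eqP.
by rewrite -eq_mulVg1 nth_uniq ?enum_uniq // => /eqP.
Qed.

Hypothesis goodR : good R.
Local Open Scope fset_scope.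

Definition shift (x : bool) (F : {fset wquot}) : {fset wquot} :=
  [fset qmul f (cls [:: x]) | f in F].

(** [separate] provides a finite quotient in which the elements of [F] stay distinct, so that
    [expansion] applies to their representatives. *)
Lemma qgroup_expansion (F : {fset wquot}) : F != fset0 -> exists x,
  3 * #|` F `&` shift x F| <= 2 * #|` F|.
Proof.
move=> F0; pose wd (f : F) := rep (val f).
pose l := [seq (wd f.1, wd f.2) | f <- enum [pred f : F * F | f.1 != f.2]].
have [|gT [pi [m s ne]]] := @separate l.
  move=> _ /mapP [[f g] + ->] /=; rewrite mem_enum /= => fg /clsP.
  by rewrite !repK => /val_inj efg; rewrite inE efg /= eqxx in fg.
have inj : injective (fun f => ev pi (wd f)).
  move=> f g efg; apply/eqP/negPn/negP => fg; apply: (ne (wd f, wd g)) => //.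
  by apply: (map_f (fun f : F * F => (wd f.1, wd f.2)) (x := (f, g))); rewrite mem_enum.
have cF : #|{: F}| = #|` F| by rewrite cardfE.
have [|x xP] := expansion p_pr goodR m s inj.
  by rewrite cF cardfs_gt0.
exists x; rewrite -cF; apply: leq_trans xP; rewrite leq_mul2l /=.
set S := [set f | _].
pose h (f : F) := qmul (val f) (cls [:: x]).
apply: leq_trans (_ : #|` h @` [fset f in S]| <= _); last first.
  by apply: leq_trans (leq_imfset_card _ _ _) _; rewrite -card_finset.
apply: fsubset_leq_card; apply/fsubsetP => y; rewrite inE => /andP [yF /imfsetP [f /= fF yf]].
apply/imfsetP; exists [` fF] => //=; rewrite !inE; apply/asboolP; exists [` yF].
by apply/clsP; rewrite /wd repK /= yf -[in RHS](repK f) qmul_cls cats1.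
Qed.

Lemma card_shift x F : #|` shift x F| = #|` F|.
Proof.
apply: card_in_imfset => f g _ _ /(congr1 (fun y => qmul y (qinv (cls [:: x])))).
by rewrite -!qmulA qmulrV !qmulr1.
Qed.

Lemma qgroup_growth (F : {fset wquot}) :
  4 * #|` F| <= 3 * #|` F `|` shift true F `|` shift false F|.
Proof.
have [->|F0] := eqVneq F fset0; first by rewrite cardfs0.
have [x xP] := qgroup_expansion F0.
apply: leq_trans (_ : 3 * #|` F `|` shift x F| <= _).
  by have := cardfsUI F (shift x F); rewrite card_shift; lia.
rewrite leq_mul2l /= fsubset_leq_card //; case: x {xP}; last first.
  by rewrite fsetUAC fsubsetUl.
by rewrite fsubsetUl.
Qed.

End WordEq.

(** * Hall's theorem and paradoxical decompositions *)

Section Hall.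
Local Open Scope fset_scope.
Variables (A B : choiceType).
Implicit Types (N : A -> {fset B}) (l M : {fset A}).

Definition nbrs N l : {fset B} := \bigcup_(a <- l) N a.
Definition hall N : Prop := forall l, #|` l| <= #|` nbrs N l|.
Definition assign N a b : A -> {fset B} := fun a' => if a' == a then [fset b] else N a'.

Lemma nbrsP N l b : reflect (exists2 a, a \in l & b \in N a) (b \in nbrs N l).
Proof.
apply: (iffP (bigfcupP _ _ _ _)) => [[a /andP [al _] bN]|[a al bN]]; exists a => //.
by rewrite al.
Qed.

Lemma nbrsU N l M : nbrs N (l `|` M) = nbrs N l `|` nbrs N M.
Proof.
apply/fsetP => b; rewrite inE; apply/nbrsP/orP.
  by move=> [a]; rewrite inE => /orP [al|al] bN; [left|right]; apply/nbrsP; exists a.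
by move=> [|] /nbrsP [a al bN]; exists a; rewrite // inE al ?orbT.
Qed.

Lemma nbrsI_sub N l M : nbrs N (l `&` M) `<=` nbrs N l `&` nbrs N M.
Proof.
apply/fsubsetP => b /nbrsP [a]; rewrite !inE => /andP [al aM] bN.
by apply/andP; split; apply/nbrsP; exists a.
Qed.

(* Tight sets, those with no more neighbours than elements, are stable under union. If no
   choice [b] for [a] preserves Hall's condition, every [b] is a neighbour of a tight set
   avoiding [a], and adding [a] to the union of these sets violates Hall's condition. *)
Lemma hall_assign N a : hall N -> exists2 b, b \in N a & hall (assign N a b).
Proof.
move=> hN; apply: contrapT => none.
have tight b : b \in N a -> exists M, [/\ a \notin M, #|` nbrs N M| <= #|` M| & b \in nbrs N M].
  move=> bN; have /existsNP [l /negP] : ~ hall (assign N a b).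
    by move=> h; apply: none; exists b.
  rewrite -ltnNge => lt_l.
  have assignE M : a \notin M -> nbrs (assign N a b) M = nbrs N M.
    move=> aM; apply: eq_big_seq => a' a'M; rewrite /assign.
    by case: eqP => // ea; rewrite -ea a'M in aM.
  have al : a \in l.
    apply: contraLR lt_l => al; rewrite -leqNgt assignE //; exact: hN.
  have el : l = [fset a] `|` (l `\ a) by rewrite fsetD1K.
  have aM : a \notin l `\ a by rewrite !inE eqxx.
  have nb1 : nbrs (assign N a b) [fset a] = [fset b].
    apply/fsetP => c; apply/nbrsP/idP => [[a']|cb].
      by rewrite inE /assign => ->.
    by exists a; rewrite ?inE // /assign eqxx.
  have := lt_l; rewrite {1}el nbrsU nb1 assignE // cardfsU1 (cardfsD1 a l) al add1n ltnS.
  have := hN (l `\ a); move=> le1 le2.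
  exists (l `\ a); split=> //; first by apply: leq_trans le2; apply: leq_addl.
  by apply: contraTT (le1) => bn; rewrite -ltnNge (leq_trans _ le2) // bn.
have [M [aM tM sub]] : exists M,
    [/\ a \notin M, #|` nbrs N M| <= #|` M| & {subset N a <= nbrs N M}].
  suff [M [aM tM sub]] : exists M, [/\ a \notin M, #|` nbrs N M| <= #|` M| &
      forall b, b \in enum_fset (N a) -> b \in nbrs N M] by exists M.
  have : {subset enum_fset (N a) <= N a} by [].
  elim: (enum_fset (N a)) => [|b s IH] sN.
    by exists fset0; split; rewrite // /nbrs big_seq_fset0.
  have [|M1 [a1 t1 s1]] := IH; first by move=> c cs; apply: sN; rewrite inE cs orbT.
  have [M2 [a2 t2 s2]] := tight b (sN b (mem_head _ _)).
  exists (M1 `|` M2); split; first by rewrite inE negb_or a1.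
    (* Submodularity: the neighbours of the intersection are common neighbours, and Hall's condition
       bounds their number from below. *)
    have := cardfsUI (nbrs N M1) (nbrs N M2); have := cardfsUI M1 M2.
    have := leq_trans (hN (M1 `&` M2)) (fsubset_leq_card (nbrsI_sub N M1 M2)).
    rewrite nbrsU; lia.
  move=> c; rewrite inE nbrsU inE => /orP [/eqP -> | /s1 -> //].
  by rewrite s2 orbT.
have := hN (a |` M); rewrite cardfsU1 aM add1n nbrsU.
have -> : nbrs N [fset a] `|` nbrs N M = nbrs N M.
  apply/fsetUidPr/fsubsetP => b /nbrsP [a']; rewrite inE => /eqP ->; exact: sub.
by rewrite ltnNge tM.
Qed.

(** Elements are committed one by one along [en], preserving Hall's condition. Every set of
    candidates ends as a singleton, and Hall's condition for a pair makes the choices distinct. *)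
Lemma hall_marriage N (en : nat -> A) : (forall a, exists k, en k = a) -> hall N ->
  exists f : A -> B, (forall a, f a \in N a) /\ injective f.
Proof.
move=> surj hN.
have [b0 _] : exists b, b \in N (en 0).
  apply/fset0Pn; rewrite -cardfs_gt0; have := hN [fset en 0].
  by rewrite cardfs1 /nbrs big_seq_fset1.
have ex (Na : (A -> {fset B}) * A) : exists b, hall Na.1 ->
    b \in Na.1 Na.2 /\ hall (assign Na.1 Na.2 b).
  have [h|h] := pselect (hall Na.1); last by exists b0.
  by have [b] := hall_assign Na.2 h; exists b.
have [ch chP] := choice ex.
pose step k N' := assign N' (en k) (ch (N', en k)).
pose Ns := fix Ns k := if k is k'.+1 then step k' (Ns k') else N.
have hNs k : hall (Ns k).
  by elim: k => [|k IH] //=; case: (chP (Ns k, en k) IH).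
have chN k : ch (Ns k, en k) \in Ns k (en k) by case: (chP (Ns k, en k) (hNs k)).
have sub k a : {subset Ns k a <= N a}.
  elim: k => [|k IH] //= b; rewrite /step /assign; case: eqP => [ea | _ /IH //].
  by rewrite inE => /eqP ->; apply: IH; rewrite ea; apply: chN.
(* The enumeration may return to [a]; the new choice then lies in the singleton already fixed. *)
have stable a b k j : Ns k a = [fset b] -> Ns (k + j)%N a = [fset b].
  move=> e0; elim: j => [|j IH]; first by rewrite addn0.
  rewrite addnS /= /step /assign; case: eqP => // ea.
  by have := chN (k + j)%N; rewrite -ea IH inE => /eqP ->.
have single a : exists b, b \in N a /\ exists k, forall j, k <= j -> Ns j a = [fset b].
  have [k ea] := surj a; exists (ch (Ns k, en k)); split.
    by rewrite -ea; apply/sub/chN.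
  exists k.+1 => j /subnKC <-; apply: stable.
  by rewrite /= /step /assign ea eqxx.
have [f fP] := choice single; exists f; split=> [a|a a' eff]; first by case: (fP a).
have [_ [k kP]] := fP a; have [_ [k' kP']] := fP a'.
apply/eqP/negPn/negP => aa'; have := hNs (maxn k k') [fset a; a'].
rewrite cardfs2 aa' nbrsU /nbrs !big_seq_fset1.
by rewrite kP ?leq_maxl // kP' ?leq_maxr // eff fsetUid cardfs1.
Qed.

End Hall.

Section Paradox.
Import Rdefinitions.
Local Open Scope R_scope.

(** The two maps sending [x] to [t (f i x)] times [x] are injective with disjoint images and
    translate finitely many pieces. Each image has measure 1, so their union would have measure
    2. *)
Lemma paradoxical_not_amenable (G : Defs.group) (k : nat) (t : nat -> G)
    (f : bool -> G -> nat) :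
  (forall i x, (f i x < k)%nat) ->
  (forall i j x y, Defs.mul (t (f i x)) x = Defs.mul (t (f j y)) y -> i = j /\ x = y) ->
  ~ Defs.amenable G.
Proof.
move=> fk inj [m [m_ge0 [m1 [mU mtr]]]].
have m0 : m (fun=> False) = 0.
  have := mU (fun=> False) (fun=> False) (fun _ f _ => f).
  have -> : (fun _ : G => False \/ False) = (fun=> False).
    by apply/funext => x; apply/propext; tauto.
  Lra.lra.
pose sum (P : nat -> G -> Prop) := foldr (fun s acc => m (P s) + acc) 0.
have msum (P : nat -> G -> Prop) l :
    (forall s s' x, P s x -> P s' x -> s = s') -> uniq l ->
    m (fun x => exists2 s, s \in l & P s x) = sum P l.
  move=> disj; elim: l => [_|s l IH /= /andP [sl ul]].
    rewrite -[RHS]m0; congr m; apply/funext => x; apply/propext; split=> //.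
    by case.
  rewrite -IH // -mU => [|x Ps [s' s'l Ps']].
    congr m; apply/funext => x; apply/propext; split.
      move=> [s']; rewrite inE => /orP [/eqP -> | s'l] Ps'; first by left.
      by right; exists s'.
    move=> [Ps|[s' s'l Ps']]; first by exists s; rewrite // mem_head.
    by exists s'; rewrite // inE s'l orbT.
  by rewrite (disj _ _ _ Ps Ps') s'l in sl.
pose P i s := fun x : G => f i x = s.
pose Q i s := fun y : G => P i s (Defs.mul (Defs.inv (t s)) y).
have sumP i : sum (P i) (iota 0 k) = 1.
  rewrite -msum ?iota_uniq // => [|s s' x <- //].
  rewrite -[RHS]m1; congr m; apply/funext => x; apply/propext; split=> // _.
  by exists (f i x); rewrite // mem_iota /= fk.
have sumQ i : sum (Q i) (iota 0 k) = 1.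
  rewrite -(sumP i); elim: (iota 0 k) => [|s l IH] //=.
  by rewrite IH mtr.
have QE i s y : Q i s y -> exists2 x, f i x = s & y = Defs.mul (t (f i x)) x.
  move=> fs; exists (Defs.mul (Defs.inv (t s)) y) => //.
  by rewrite fs Defs.mulA Defs.mulgV Defs.mul1g.
have Qdisj i j s s' y : Q i s y -> Q j s' y -> i = j /\ s = s'.
  move=> /QE [x <- ->] /QE [x' <- /inj [-> ->]] //.
have sQ i : m (fun y => exists2 s, s \in iota 0 k & Q i s y) = 1.
  rewrite -(sumQ i) msum ?iota_uniq // => s s' y q q'.
  by have [] := Qdisj _ _ _ _ _ q q'.
pose U y := (exists2 s, s \in iota 0 k & Q true s y) \/ (exists2 s, s \in iota 0 k & Q false s y).
have mU2 : m U = 2.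
  rewrite /U mU ?sQ => [|y [s _ q] [s' _ q']]; first Lra.lra.
  by have [] := Qdisj _ _ _ _ _ q q'.
have := mU U (fun y => ~ U y) (fun y u nu => nu u).
have -> : (fun y => U y \/ ~ U y) = (fun=> True).
  apply/funext => y; apply/propext; split=> // _; exact: EM.
by have := m_ge0 (fun y => ~ U y); rewrite m1 mU2; Lra.lra.
Qed.

End Paradox.

(** * Non-amenability and infinitude of the groups *)

Section NonAmenable.
Local Open Scope fset_scope.
Variables (p : nat) (p_pr : prime p) (R : word * nat -> Prop).
Hypothesis tors : forall w, exists e, word_eq p R (wpow w (p ^ e)) [::].
Hypothesis goodR : good R.
Local Notation Q := (wquot p R).
Local Notation G := (qgroup p_pr tors).
Implicit Types F S : {fset Q}.

Definition setmul F S : {fset Q} := [fset qmul x y | x in F, y in S].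

Lemma setmulP F S z :
  reflect (exists x y, [/\ x \in F, y \in S & z = qmul x y]) (z \in setmul F S).
Proof.
apply: (iffP idP) => [/imfset2P [x /= xF [y /= yS ->]]|[x [y [xF yS ->]]]]; first by exists x, y.
by apply/imfset2P; exists x => //; exists y.
Qed.

Definition ball1 : {fset Q} := [fset cls p R [::]; cls p R [:: true]; cls p R [:: false]].

Lemma setmul_growth F : 4 * #|` F| <= 3 * #|` setmul F ball1|.
Proof.
apply: leq_trans (qgroup_growth p_pr tors goodR F) _.
rewrite leq_mul2l /=; apply/fsubset_leq_card/fsubsetP => z; rewrite !inE -orbA.
have b1 b : cls p R [:: b] \in ball1 by rewrite !inE; case: b; rewrite eqxx ?orbT.
case/or3P => [zF|/imfsetP [x /= xF ->]|/imfsetP [x /= xF ->]]; apply/setmulP.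
- by exists z, (cls p R [::]); rewrite qmulr1 !inE eqxx.
- by exists x, (cls p R [:: true]).
- by exists x, (cls p R [:: false]).
Qed.

Definition ball3 : {fset Q} := setmul (setmul ball1 ball1) ball1.

(** Three steps of growth by [4/3] give [64/27], which exceeds 2. *)
Lemma ball3_growth F : 2 * #|` F| <= #|` setmul F ball3|.
Proof.
have g1 := setmul_growth F; have g2 := setmul_growth (setmul F ball1).
have g3 := setmul_growth (setmul (setmul F ball1) ball1).
apply: (@leq_trans #|` setmul (setmul (setmul F ball1) ball1) ball1|); first lia.
apply/fsubset_leq_card/fsubsetP => z.
move=> /setmulP [y [c [/setmulP [x [b [/setmulP [f [a [fF aB ->]]] bB ->]]] cB ->]]].
apply/setmulP; exists f, (qmul (qmul a b) c); rewrite !qmulA; split=> //.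
by apply/setmulP; exists (qmul a b), c; split=> //; apply/setmulP; exists a, b.
Qed.

Lemma paradoxical_injection : exists h : bool * Q -> Q,
  (forall x, exists2 s, s \in ball3 & h x = qmul x.2 s) /\ injective h.
Proof.
pose N (x : bool * Q) := setmul [fset x.2] ball3.
pose en (k : nat) : bool * Q :=
  if (choice.unpickle k : option (bool * word)) is Some (b, w) then (b, cls p R w)
  else (true, cls p R [::]).
have [x|l|h [hN hinj]] := @hall_marriage _ _ N en.
- exists (choice.pickle (x.1, rep x.2)); rewrite /en choice.pickleK repK.
  by case: x.
(* At most two pairs in [l] lie over each point of its projection [F], and multiplying by [ball3] at
   least doubles [F]. *)
- pose F : {fset Q} := [fset x.2 | x in l].
  apply: (@leq_trans (2 * #|` F|)).
    rewrite mul2n -addnn.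
    apply: (@leq_trans #|` [fset (true, y) | y in F] `|` [fset (false, y) | y in F]|).
      apply/fsubset_leq_card/fsubsetP => -[b y] xl.
      have yF : y \in F by apply/imfsetP; exists (b, y).
      by rewrite inE; case: b {xl}; apply/orP; [left|right]; apply/imfsetP; exists y.
    rewrite cardfsU; apply: leq_trans (leq_subr _ _) _; rewrite leq_add //.
      by apply: leq_trans (leq_imfset_card _ _ _) _.
    by apply: leq_trans (leq_imfset_card _ _ _) _.
  apply: leq_trans (ball3_growth F) _.
  apply/fsubset_leq_card/fsubsetP => z /setmulP [y [s [/imfsetP [x /= xl ->] sB ->]]].
  apply/nbrsP; exists x => //; apply/setmulP; exists x.2, s.
  by rewrite inE eqxx.
exists h; split=> // x; have /setmulP [y [s [+ sB ->]]] := hN x.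
by rewrite inE => /eqP ->; exists s.
Qed.

Lemma qgroup_not_amenable : ~ Defs.amenable G.
Proof.
have [h [hP hinj]] := paradoxical_injection.
have hP' x : exists s, s \in ball3 /\ h x = qmul x.2 s by have [s] := hP x; exists s.
have [s sP] := choice hP'.
pose inv := qinv tors.
have mulV x : qmul (inv x) x = cls p R [::] by apply: qmulV.
have mulrV x : qmul x (inv x) = cls p R [::] by apply: qmulrV.
have invK x : inv (inv x) = x.
  by rewrite -[LHS]qmulr1 -(mulV x) qmulA mulV qmul1.
have invM x y : inv (qmul x y) = qmul (inv y) (inv x).
  rewrite -[RHS]qmulr1 -(mulrV (qmul x y)) !qmulA.
  by rewrite -(qmulA (inv y)) mulV qmulr1 mulV qmul1.
(* The map [h] multiplies on the right, while the mean is invariant under left translations;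
   conjugation by inversion turns one into the other. *)
pose t k : G := inv (nth (cls p R [::]) ball3 k).
pose f i (x : G) := index (s (i, inv x)) ball3.
have tf i x : t (f i x) = inv (s (i, inv x)) by rewrite /t nth_index //; case: (sP (i, inv x)).
apply: (@paradoxical_not_amenable G (size ball3) t f) => [i x|i j x y].
  by rewrite index_mem; case: (sP (i, inv x)).
have hE i' (x' : Q) : @Defs.mul G (inv (s (i', inv x'))) x' = inv (h (i', inv x')) :> Q.
  by rewrite (sP _).2 invM invK.
rewrite !tf !hE => /(congr1 inv); rewrite !invK => /hinj [-> /(congr1 inv)].
by rewrite !invK.
Qed.

Lemma qgroup_infinite : Defs.infinite_group G.
Proof.
move=> [l lP]; pose F : {fset Q} := seq_fset tt l.
have FP x : x \in F by rewrite seq_fsetE; apply/InP/lP.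
have := ball3_growth F.
have : 0 < #|` F| by rewrite cardfs_gt0; apply/fset0Pn; exists (cls p R [::]).
have : #|` setmul F ball3| <= #|` F| by apply/fsubset_leq_card/fsubsetP => x _.
lia.
Qed.

End NonAmenable.

(** * Diagonal construction *)

Section Diagonal.
Variables (p : nat) (p_pr : prime p).
Implicit Types L : seq (word * nat).

(** Over the integers a repeated loop does not have sum zero by itself, so [loop_with_nonzero_sum]
    asks for a group in which every relator has its full order. *)
Definition exact_orders L : Prop := exists (gT : finGroupType) (pi : bool -> gT),
  pmark p pi /\ forall x, x \in L -> #[ev pi x.1]%g = p ^ x.2.

Definition unbounded L u : Prop := forall b, exists (gT : finGroupType) (pi : bool -> gT),
  [/\ pmark p pi, sat p (fun x => x \in L) pi & (ev pi u ^+ (p ^ b) != 1)%g].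

(** Let [p ^ e] be the order of [u] in a quotient where this order is large. The product with the
    old witness, whose exponent divides [p ^ e], gives [u] order [p ^ e] and leaves the orders of
    the old relators unchanged, as the new quotient satisfies them. *)
Lemma add_relator L u b : sparse L -> exact_orders L -> unbounded L u ->
  exists e, [/\ b <= e, sparse ((u, e) :: L) & exact_orders ((u, e) :: L)].
Proof.
move=> okL [gT [pi [m ord]]] unb; have [c cP] := pmark_pel p_pr m.
have [gT1 [pi1 [m1 s1 ne1]]] := unb (maxn b (maxn c (size L + 2))).
have [c1 /(_ (ev pi1 u)) /eqP] := pmark_pel p_pr m1; rewrite -order_dvdn.
move=> /(dvdn_pfactor _ _ p_pr) [e _ oe].
have : maxn b (maxn c (size L + 2)) < e.
  by rewrite ltnNge; apply: contra ne1 => le; rewrite -order_dvdn oe dvdn_exp2l.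
rewrite !gtn_max => /and3P [be ce se].
exists e; split; [exact: ltnW | by rewrite /= okL ltnW |].
have [hT [rho [mr rP]]] := pmark_prod p_pr m m1.
have dvd w n : (#[ev rho w]%g %| n) = (#[ev pi w]%g %| n) && (#[ev pi1 w]%g %| n).
  rewrite !order_dvdn -!ev_wpow; apply/eqP/andP.
    by rewrite -{1}(ev_nil rho) => /rP [-> ->]; rewrite !ev_nil !eqxx.
  by move=> [/eqP e1 /eqP e2]; rewrite -(ev_nil rho); apply/rP; rewrite e1 e2 !ev_nil.
have ordE w n : (#[ev rho w]%g == n) = (lcmn #[ev pi w]%g #[ev pi1 w]%g == n).
  suff -> : #[ev rho w]%g = lcmn #[ev pi w]%g #[ev pi1 w]%g by [].
  apply/eqP; rewrite eqn_dvd dvdn_lcm -dvd dvdnn andbT dvd.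
  by rewrite dvdn_lcml dvdn_lcmr.
exists hT, rho; split=> // x; rewrite inE => /orP [/eqP -> | xL]; apply/eqP; rewrite ordE.
  rewrite /= oe; apply/eqP/lcmn_idPr.
  by rewrite order_dvdn -(subnKC (ltnW ce)) expnD expgM cP expg1n.
by rewrite (ord x xL); apply/eqP/lcmn_idPl; rewrite order_dvdn s1.
Qed.

Variable K : nat -> word -> word -> Prop.

(* A state consists of the relators chosen so far and a lower bound for the exponents
   of all later relators. The marked group of the first alternative of [separated] is killed
   by this bound, so it satisfies all later relators and witnesses that the relation
   [u ^ (p ^ e) = 1] never becomes true. *)
Definition separated i (s : seq (word * nat) * nat) : Prop := exists u e,
  (K i (wpow u (p ^ e)) [::] /\ exists (gT : finGroupType) (pi : bool -> gT),
     [/\ pmark p pi, sat p (fun x => x \in s.1) pi, forall g : gT, (g ^+ (p ^ s.2) = 1)%g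
       & (ev pi u ^+ (p ^ e) != 1)%g]) \/
  (~ K i (wpow u (p ^ e)) [::] /\ (u, e) \in s.1).

Definition made_torsion w (s : seq (word * nat) * nat) : Prop := exists e,
  forall (gT : finGroupType) (pi : bool -> gT),
    pmark p pi -> sat p (fun x => x \in s.1) pi -> (ev pi w ^+ (p ^ e) = 1)%g.

Definition requirement (r : option (word + nat)) s : Prop :=
  match r with
  | Some (inl w) => made_torsion w s
  | Some (inr i) => separated i s
  | None => True
  end.

Definition valid (s : seq (word * nat) * nat) : Prop := sparse s.1 /\ exact_orders s.1.

Definition extends (s s' : seq (word * nat) * nat) : Prop :=
  s'.1 = s.1 \/ exists u e, s'.1 = (u, e) :: s.1 /\ s.2 <= e.

(** To differ from [K i], an unbounded word [u] gets a relator exactly when [K i] denies it. To make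
    [w] torsion, a relator is added if its order is still unbounded. *)
Lemma next_state k s : valid s -> exists s',
  [/\ valid s', extends s s', s.2 + k < s'.2 & requirement (choice.unpickle k) s'].
Proof.
case: s => L m [okL exL]; case: (choice.unpickle k) => [[w|i]|]; last first.
- by exists (L, m + k.+1); split=> //=; [left | lia].
- have [gT [pi [mpi ord]]] := exL.
  have [u unb] := exists_unbounded_word p_pr okL mpi ord.
  have [e [me ok' ex']] := add_relator m okL exL unb.
  have [Ku|nKu] := pselect (K i (wpow u (p ^ e)) [::]).
    (* The exponent of this witness is [p ^ c] at most; the new bound exceeds [c], so every later
       relator holds in it. *)
    have [hT [rho [mr sr ne]]] := unb e; have [c cP] := pmark_pel p_pr mr.
    exists (L, m + k + c.+1); split=> //=; [by left | lia |].
    exists u, e; left; split=> //; exists hT, rho; split=> //= g.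
    by rewrite addnS -addSn addnC expnD expgM cP expg1n.
  exists ((u, e) :: L, m + k.+1); split=> //=; [by right; exists u, e | lia |].
  by exists u, e; right; rewrite inE eqxx.
have [unb|] := pselect (unbounded L w).
  have [e [me ok' ex']] := add_relator m okL exL unb.
  exists ((w, e) :: L, m + k.+1); split=> //=; [by right; exists w, e | lia |].
  by exists e => gT pi _ /(_ (w, e)) -> //=; rewrite inE eqxx.
move=> /existsNP [b nb]; exists (L, m + k.+1); split=> //=; [by left | lia |].
exists b => gT pi mpi s; apply/eqP/negPn/negP => ne; apply: nb.
by exists gT, pi.
Qed.

(** Stage [k] meets the requirement with code [k], and [R] collects the relators of all stages. *)
Lemma diagonal_relators : exists R : word * nat -> Prop,
  [/\ good R, forall w, exists e, word_eq p R (wpow w (p ^ e)) [::] &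
      forall i, ~ forall u v, K i u v <-> word_eq p R u v].
Proof.
have ex (ks : nat * (seq (word * nat) * nat)) : exists s', valid ks.2 ->
    [/\ valid s', extends ks.2 s', ks.2.2 + ks.1 < s'.2 & requirement (choice.unpickle ks.1) s'].
  have [v|nv] := pselect (valid ks.2); last by exists ks.2.
  by have [s' ?] := next_state ks.1 v; exists s'.
have [nx nxP] := choice ex.
pose st := fix st k := if k is k'.+1 then nx (k', st k') else ([::] : seq (word * nat), 0).
have st0 : valid (st 0).
  split=> //; have [gT [pi [m _]]] := pmark_trivial p_pr.
  by exists gT, pi.
have stv k : valid (st k) by elim: k => [|k IH] //=; case: (nxP (k, st k) IH).
have stS k : [/\ extends (st k) (st k.+1), (st k).2 + k < (st k.+1).2 &
    requirement (choice.unpickle k) (st k.+1)] by case: (nxP (k, st k) (stv k)).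
have bnd k : k <= (st k).2.
  by elim: k => [|k IH] //; have [_ lt _] := stS k; apply: leq_trans lt; rewrite ltnS leq_addl.
have bmono k j : (st k).2 <= (st (k + j)).2.
  elim: j => [|j IH]; first by rewrite addn0.
  rewrite addnS; have [_ lt _] := stS (k + j); apply: leq_trans IH _.
  by apply: leq_trans (ltnW lt); apply: leq_addr.
have mono k j x : x \in (st k).1 -> x \in (st (k + j)).1.
  elim: j => [|j IH] xk; first by rewrite addn0.
  rewrite addnS; have [[->|[u [e [-> _]]]] _ _] := stS (k + j); first exact: IH.
  by rewrite inE IH ?orbT.
have late k j x : x \in (st (k + j)).1 -> x \in (st k).1 \/ (st k).2 <= x.2.
  elim: j => [|j IH]; first by rewrite addn0; left.
  rewrite addnS; have [[->|[u [e [-> le]]]] _ _] := stS (k + j); first exact: IH.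
  rewrite inE => /orP [/eqP -> /=|]; last exact: IH.
  by right; apply: leq_trans le.
pose R x := exists k, x \in (st k).1.
have lateR k x : R x -> x \in (st k).1 \/ (st k).2 <= x.2.
  by move=> [j xj]; apply: (late k j); rewrite addnC; apply: mono.
exists R; split=> [n|w|i].
(* A relator first added after stage [n + 1] has exponent at least [n + 1]. *)
- exists (st n.+1).1; split=> [|x /(lateR n.+1) [//|le] xn]; first by case: (stv n.+1).
  by have := leq_trans (bnd n.+1) (leq_trans le xn); rewrite ltnn.
- have [_ _] := stS (choice.pickle (inl w : word + nat)); rewrite choice.pickleK => -[e eP].
  exists e => gT pi mpi s; rewrite ev_wpow ev_nil; apply: eP => // x xk; apply: s.
  by exists (choice.pickle (inl w : word + nat)).+1.
have [_ _] := stS (choice.pickle (inr i : word + nat)); rewrite choice.pickleK.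
set k := choice.pickle _ => -[u [e [[Ku [gT [pi [mpi s kill ne]]]]|[nK inL]]]] KR.
  have /(_ gT pi mpi) := (KR _ _).1 Ku; rewrite ev_wpow ev_nil => h; move/eqP: ne; apply.
  apply: h => x /(lateR k.+1) [/s //|le].
  by rewrite -(subnKC le) expnD expgM kill expg1n.
apply: nK; apply/KR => gT pi mpi s; rewrite ev_wpow ev_nil.
by apply: (s (u, e)); exists k.+1.
Qed.

End Diagonal.

(** * Commensurability *)

Section Commensurability.
Import Defs.

Lemma commensurable_refl (G : group) : commensurable G G.
Proof.
have fi : finite_index (fun _ : G => True).
  exists 1, [:: one]; split=> //; split=> [x|[|i] [|j] /ltP // _ /ltP //].
  by exists one; split=> //; left.
by exists (fun=> True), (fun=> True), id; do !split=> //; move=> y _; exists y.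
Qed.

Lemma commensurable_sym (G1 G2 : group) : commensurable G1 G2 -> commensurable G2 G1.
Proof.
move=> [H1 [H2 [f [sH1 [fi1 [sH2 [fi2 [fH [fM [finj fsurj]]]]]]]]]].
have ex y : exists x, H2 y -> H1 x /\ f x = y.
  have [/fsurj [x ?]|h] := pselect (H2 y); first by exists x.
  by exists one.
have [g gP] := choice ex; exists H2, H1, g.
do 4 (split; first by []); split; last split; last split.
- by move=> y /gP [].
- move=> x y Hx Hy; have [_ [HM _]] := sH2; have [_ [HM1 _]] := sH1.
  have [g1 e1] := gP _ Hx; have [g2 e2] := gP _ Hy; have [g3 e3] := gP _ (HM _ _ Hx Hy).
  by apply: finj => //; [exact: HM1 | rewrite fM // e1 e2 e3].
- by move=> x y /gP [_ ex1] /gP [_ ey1] e; rewrite -ex1 -ey1 e.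
- move=> x Hx; exists (f x); split; first exact: fH.
  by have [h e] := gP _ (fH _ Hx); apply: finj.
Qed.

(* Coset data of a group [G2] commensurable with [G]: a word evaluates in [G2] to a coset
   representative, given by its index, times an element of the common subgroup, viewed
   in [G] through an enumeration [dec] of [G]. *)
Definition coset_table := ((nat * nat) * seq (nat * nat))%type.

Fixpoint run (G : group) (dec : nat -> G) (d : coset_table) (w : word) : nat * G :=
  if w is x :: w' then
    let: (i, h) := run dec d w' in
    let: (j, a) := nth (0, 0) d.2 (x + i.*2) in (j, mul (dec a) h)
  else (d.1.1, dec d.1.2).

(** Every element of [G2] is [r i * f h] for a unique coset index [i] and a unique [h] in [H1]. If
    [gen x * r i = r j * f a], then prepending [x] turns [(i, h)] into [(j, a * h)]; entry
    [x + 2 * i] of the table stores [j] and a code of [a]. *)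
Lemma commensurable_run (G G2 : group) (dec : nat -> G) (val : word -> G2) (gen : bool -> G2) :
  (forall g, exists k, dec k = g) ->
  val [::] = one -> (forall x w, val (x :: w) = mul (gen x) (val w)) ->
  commensurable G G2 ->
  exists d, forall u v, run dec d u = run dec d v <-> val u = val v.
Proof.
move=> surj v0 vS [H1 [H2 [f [sH1 [_ [sH2 [[n [l [ln [cov disj]]]] [fH [fM [finj fsurj]]]]]]]]]].
have [cd cdK] := choice surj.
pose r i := List.nth i l one.
have ex y : exists ih : nat * G, [/\ ih.1 < n, H1 ih.2 & y = mul (r ih.1) (f ih.2)].
  have [g [/(List.In_nth _ _ one) [i [/ltP il ei]] /fsurj [h [Hh fh]]]] := cov y.
  exists (i, h); split=> //=; first by rewrite -ln.
  by rewrite /r ei fh mulA mulgV mul1g.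
have [ih ihP] := choice ex.
pose enc y := ((ih y).1, cd (ih y).2).
pose d : coset_table := (enc one, mkseq (fun k => enc (mul (gen (odd k)) (r k./2))) n.*2).
have runP w : [/\ (run dec d w).1 < n, H1 (run dec d w).2 &
    val w = mul (r (run dec d w).1) (f (run dec d w).2)].
  elim: w => [|x w]; first by rewrite v0 /= cdK; case: (ihP one).
  rewrite vS [run dec d (x :: w)]/=; case: (run dec d w) => i h [/= lti Hh ->].
  rewrite nth_mkseq; last by case: x; rewrite ?ltn_Sdouble ?ltn_double.
  rewrite half_bit_double oddD odd_double addbF oddb /enc /= cdK.
  case: (ih _) (ihP (mul (gen x) (r i))) => j a /= [lj Ha ey].
  have [_ [HM _]] := sH1.
  by split=> //; [exact: HM | rewrite mulA ey fM // mulA].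
exists d => u v; split=> [e|].
  by have [_ _ ->] := runP u; have [_ _ ->] := runP v; rewrite e.
have [] := runP u; have [] := runP v.
case: (run dec d u) (run dec d v) => [i h] [i' h'] /= lti' Hh' -> lti Hh -> e.
have [_ [HM HV]] := sH2.
have ei : i = i'.
  apply: contrapT => ne; apply: (disj i i' (ltP lti) (ltP lti') ne); rewrite -!/(r _).
  have -> : mul (inv (r i)) (r i') = mul (f h) (inv (f h')).
    rewrite -[LHS]mulg1 -(mulgV _ (f h')) mulA -(mulA _ (inv (r i))) -e.
    by rewrite mulA mulVg mul1g.
  by apply: HM; [apply: fH | apply/HV/fH].
rewrite -ei in e *; congr (_, _); apply: finj => //.
by rewrite -[LHS]mul1g -(mulVg _ (r i)) -mulA e mulA mulVg mul1g.
Qed.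

End Commensurability.

Import classical_sets.

(** * Maximal families of pairwise non-commensurable groups *)

Section Family.
Variables (p : nat) (p_pr : prime p).

Definition torsion_relators (R : word * nat -> Prop) : Prop :=
  forall w, exists e, word_eq p R (wpow w (p ^ e)) [::].

Definition family : Type := {R : word * nat -> Prop | good R /\ torsion_relators R}.

Definition family_group (t : family) : Defs.group := qgroup p_pr (proj2 (svalP t)).

Definition enumerate (t : family) (k : nat) : family_group t :=
  cls p (sval t) (odflt [::] (choice.unpickle k)).

Lemma enumerate_surj t g : exists k, enumerate t k = g.
Proof.
by exists (choice.pickle (rep g)); rewrite /enumerate choice.pickleK /= repK.
Qed.

Lemma family_commensurable_run (s t : family) :
  Defs.commensurable (family_group s) (family_group t) ->
  exists d, forall u v, run (enumerate s) d u = run (enumerate s) d v <-> word_eq p (sval t) u v.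
Proof.
move=> comm.
have [||d dP] := @commensurable_run _ (family_group t) (enumerate s) (cls p (sval t))
  (fun b => cls p (sval t) [:: b]) (@enumerate_surj s) _ _ comm.
- by [].
- by move=> x w; rewrite [Defs.mul _ _]qmul_cls.
by exists d => u v; rewrite dP; apply: clsP.
Qed.

(** A group commensurable with no member of a maximal [M] could be added to [M]. *)
Lemma maximal_noncommensurable : exists M : set family,
  (forall s t, M s -> M t -> s <> t -> ~ Defs.commensurable (family_group s) (family_group t)) /\
  (forall t, exists2 s, M s & Defs.commensurable (family_group s) (family_group t)).
Proof.
pose P (M : set family) := forall s t, M s -> M t -> s <> t ->
  ~ Defs.commensurable (family_group s) (family_group t).
have [F FP Ftot|M [PM maxM]] := @Zorn_bigcup _ P.
  move=> s t [A FA As] [B FB Bt].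
  have [AB|BA] := Ftot A B FA FB; first by apply: (FP B) => //; apply: AB.
  by apply: (FP A) => //; apply: BA.
exists M; split=> // t; apply: contrapT => nt.
have nc s : M s -> ~ Defs.commensurable (family_group s) (family_group t).
  by move=> Ms c; apply: nt; exists s.
apply: (maxM (M `|` [set t])%classic).
  split=> [s Ms|]; first by left.
  move=> /(_ t (or_intror erefl)) Mt; exact: (nc t Mt) (commensurable_refl _).
move=> r s [Mr|->] [Ms|->] rs //; first exact: PM; first exact: nc.
by move=> /commensurable_sym; apply: nc.
Qed.

(** If the maximal family were countable, its members and coset tables would list the kernels of all
    groups commensurable with a member. The diagonal group avoids this list, against maximality. *)
Lemma uncountable_noncommensurable : exists (I : Type) (F : I -> family),
  ~ Defs.countable_type I /\
  forall i j, i <> j -> ~ Defs.commensurable (family_group (F i)) (family_group (F j)).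
Proof.
have [M [Mne Mmax]] := maximal_noncommensurable.
exists {t | M t}, sval; split; last first.
  move=> [s Ms] [t Mt] st; apply: Mne => //= e; apply: st.
  by move: Ms; rewrite e => Ms; congr exist; apply: Prop_irrelevance.
move=> [c c_inj].
have [en enP] : exists en : nat -> option {t | M t}, forall i, en (c i) = Some i.
  have ex k : exists o, forall i, c i = k -> o = Some i.
    have [[i ci]|no] := pselect (exists i, c i = k).
      by exists (Some i) => j cj; congr Some; apply: c_inj; rewrite ci.
    by exists None => i ci; case: no; exists i.
  by have [en enP] := choice ex; exists en => i; apply: enP.
(* Codes that name no member of [M] get the total relation, a harmless extra entry of the list. *)
pose K k u v := if (choice.unpickle k : option (nat * coset_table)) is Some (n, d) then
    if en n is Some i then run (enumerate (sval i)) d u = run (enumerate (sval i)) d v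
    else True
  else True.
have [R [gR tR nR]] := diagonal_relators p_pr K.
pose t : family := exist _ R (conj gR tR).
have [s Ms comm] := Mmax t; have [d dP] := family_commensurable_run comm.
pose i : {t | M t} := exist _ s Ms.
apply: (nR (choice.pickle (c i, d))) => u v.
by rewrite /K choice.pickleK enP.
Qed.

End Family.

Require Import Defs.
From Stdlib Require Import Reals List ZArith Znumtheory.

Theorem theorem4p4 (p : nat) (hp : prime (Z.of_nat p)) :
  exists (I : Type) (F : I -> group),
    ~ countable_type I /\
    (forall i j, i <> j -> ~ commensurable (F i) (F j)) /\
    (forall i, finitely_generated (F i) /\ infinite_group (F i) /\
               torsion (F i) /\ ~ amenable (F i) /\ residually_p p (F i)).
Proof.
have p_pr : prime.prime p.
  apply/primeP; split.
    by have := prime_ge_2 _ hp; lia.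
  move=> d /dvdnP [k pk].
  have /(prime_divisors _ hp) : (Z.of_nat d | Z.of_nat p)%Z.
    by exists (Z.of_nat k); rewrite pk; lia.
  by move=> dv; apply/orP; rewrite -!(rwP eqP); lia.
have [I [F [unc ne]]] := uncountable_noncommensurable p_pr.
exists I, (fun i => family_group p_pr (F i)); split=> //; split=> // i.
have [gR tR] := svalP (F i).
split; first exact: qgroup_fg.
split; first exact: qgroup_infinite.
split; first exact: qgroup_torsion.
split; first exact: qgroup_not_amenable.
exact: qgroup_residually_p.
Qed.
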